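(* Let $\mathsf{grt}_1^{\mathrm{em}}$ be the graded $\mathbb{Q}$-vector space of all $\varphi=\varphi(x,y)\in\mathsf{lie}_2$ satisfying the three equations \begin{align*} &\varphi(y,0)-\varphi(x+y,0)=0,\\ &(\partial_y\varphi)(x,y)+(\partial_y\varphi)(y,0)-(\partial_y\varphi)(x+y,0)-R(\varphi)=0,\\ &[x,\varphi(y,x)]+[y,\varphi(x,y)]=0, \end{align*} and for $\varphi\in\mathsf{lie}_2$ put $\nu^{\mathrm{em}}(\varphi):=(\varphi(y,x),\varphi(x,y))\in\mathsf{lie}_2\oplus\mathsf{lie}_2$. Then: (i) For any $\varphi\in\mathsf{grt}_1^{\mathrm{em}}$ we have $\nu^{\mathrm{em}}(\varphi)\in\mathsf{krv}_2^{\mathrm{sym}}$. (ii) The map $\nu^{\mathrm{em}}:\mathsf{grt}_1^{\mathrm{em}}\to(\mathsf{krv}_2^{\mathrm{sym}})_{\ge 2}$ is a graded linear isomorphism.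
   Context: We work over $\mathbb{Q}$. $\mathsf{ass}_2=\mathsf{ass}(x,y)$ is the free associative algebra on $x,y$ and $\mathsf{lie}_2=\mathsf{lie}(x,y)\subset\mathsf{ass}_2$ is the free Lie algebra, both graded by $\deg x=\deg y=1$. For $a\in\mathsf{lie}_2$, the elements $\partial_x a,\partial_y a\in\mathsf{ass}_2$ are defined by $a=(\partial_x a)x+(\partial_y a)y$. For $g(x,y)\in\mathsf{ass}_2$, expressions such as $g(y,0)$, $g(x+y,0)$, $g(y,x)$ denote the results of substitution (algebra homomorphisms). $\iota$ is the anti-automorphism of $\mathsf{ass}_2$ with $\iota(x)=-x$, $\iota(y)=-y$. $R:\mathsf{lie}_2\to\mathsf{ass}_2$ is the unique linear map with $R(x)=R(y)=0$ and, for all $a,b\in\mathsf{lie}_2$, $$R([a,b])=[R(a),b]+[a,R(b)]+(\partial_x b)x\,\iota(\partial_x a)-(\partial_x a)x\,\iota(\partial_x b)+(\partial_y b)y\,\iota(\partial_y a)-(\partial_y a)y\,\iota(\partial_y b).$$ Kashiwara-Vergne Lie algebra: let $\mathsf{tr}_2=\mathsf{ass}_2/[\mathsf{ass}_2,\mathsf{ass}_2]$ (the quotient by the linear span of commutators), with projection $|\cdot|:\mathsf{ass}_2\to\mathsf{tr}_2$. Then $\mathsf{krv}_2$ is the graded vector space of pairs $(u,v)\in\mathsf{lie}_2\oplus\mathsf{lie}_2$ such that $[x,u]+[y,v]=0$ and such that there exist $f_0,f_1,f_2\in\mathbb{Q}[[s]]$ with $$|x(\partial_x u)+y(\partial_y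 v)|=|f_0(x+y)+f_1(x)+f_2(y)|$$ (an equality in the degree completion of $\mathsf{tr}_2$). The grading on pairs is induced by that of $\mathsf{lie}_2$. $\mathsf{krv}_2^{\mathrm{sym}}\subset\mathsf{krv}_2$ is the subspace of symmetric elements, i.e. those $(u,v)$ with $v(x,y)=u(y,x)$, and $(\mathsf{krv}_2^{\mathrm{sym}})_{\ge2}$ is its part of degree at least $2$. *)

(* Defs.v *)
From HB Require Import structures.
From mathcomp Require Import all_boot all_order all_algebra.
From mathcomp Require Import finmap monalg.
From mathcomp Require Import boolp.

Set Implicit Arguments.
Unset Strict Implicit.
Unset Printing Implicit Defensive.

Import GRing.Theory.

Local Open Scope ring_scope.

(* The free associative algebra on x and y over the rationals, as the monoid
   algebra of the free monoid on [bool]: the letter [false] stands for x and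
   [true] for y.  It is wrapped only in order to lock the operations: with the
   bare product of [malg], a failing unification of two products takes half a
   minute. *)
Record ass2 : predArgType := Ass2 { malg_of : {malg rat[{fmonom bool}]} }.

HB.instance Definition _ := [isNew for malg_of].
HB.instance Definition _ := [Choice of ass2 by <:].

HB.lock Definition ass2_zero := Ass2 0.
HB.lock Definition ass2_one := Ass2 1.
HB.lock Definition ass2_opp (a : ass2) := Ass2 (- malg_of a).
HB.lock Definition ass2_add (a b : ass2) := Ass2 (malg_of a + malg_of b).
HB.lock Definition ass2_mul (a b : ass2) := Ass2 (malg_of a * malg_of b).
HB.lock Definition ass2_scale (c : rat) (a : ass2) := Ass2 (c *: malg_of a).

Definition ass2_unlock :=
  (ass2_zero.unlock, ass2_one.unlock, ass2_opp.unlock, ass2_add.unlock,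
   ass2_mul.unlock, ass2_scale.unlock).

Fact ass2_addA : associative ass2_add.
Proof. by move=> a b c; apply: val_inj; rewrite !ass2_unlock /= addrA. Qed.

Fact ass2_addC : commutative ass2_add.
Proof. by move=> a b; apply: val_inj; rewrite !ass2_unlock /= addrC. Qed.

Fact ass2_add0 : left_id ass2_zero ass2_add.
Proof. by move=> a; apply: val_inj; rewrite !ass2_unlock /= add0r. Qed.

Fact ass2_addN : left_inverse ass2_zero ass2_opp ass2_add.
Proof. by move=> a; apply: val_inj; rewrite !ass2_unlock /= addNr. Qed.

HB.instance Definition _ := GRing.isZmodule.Build ass2
  ass2_addA ass2_addC ass2_add0 ass2_addN.

Lemma malg_of0 : malg_of 0 = 0.
Proof. exact: (congr1 malg_of ass2_zero.unlock). Qed.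

Lemma malg_ofD a b : malg_of (a + b) = malg_of a + malg_of b.
Proof. exact: (congr1 (fun f => malg_of (f a b)) ass2_add.unlock). Qed.

Fact ass2_scaleA b c a : ass2_scale b (ass2_scale c a) = ass2_scale (b * c) a.
Proof. by apply: val_inj; rewrite !ass2_unlock /= scalerA. Qed.

Fact ass2_scale1 : left_id 1 ass2_scale.
Proof. by move=> a; apply: val_inj; rewrite !ass2_unlock /= scale1r. Qed.

Fact ass2_scaleDr : right_distributive ass2_scale +%R.
Proof.
move=> c a b; apply: val_inj.
by rewrite /= malg_ofD !ass2_unlock /= malg_ofD scalerDr.
Qed.

Fact ass2_scaleDl a : {morph ass2_scale^~ a : b c / b + c}.
Proof.
by move=> b c; apply: val_inj; rewrite /= malg_ofD !ass2_unlock /= scalerDl.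
Qed.

HB.instance Definition _ := GRing.Zmodule_isLmodule.Build rat ass2
  ass2_scaleA ass2_scale1 ass2_scaleDr ass2_scaleDl.

Lemma malg_ofZ c (a : ass2) : malg_of (c *: a) = c *: malg_of a.
Proof. exact: (congr1 (fun f => malg_of (f c a)) ass2_scale.unlock). Qed.

Fact ass2_mulA : associative ass2_mul.
Proof. by move=> a b c; apply: val_inj; rewrite !ass2_unlock /= mulrA. Qed.

Fact ass2_mul1 : left_id ass2_one ass2_mul.
Proof. by move=> a; apply: val_inj; rewrite !ass2_unlock /= mul1r. Qed.

Fact ass2_mulr1 : right_id ass2_one ass2_mul.
Proof. by move=> a; apply: val_inj; rewrite !ass2_unlock /= mulr1. Qed.

Fact ass2_mulDl : left_distributive ass2_mul +%R.
Proof.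
move=> a b c; apply: val_inj.
by rewrite /= malg_ofD !ass2_unlock /= malg_ofD mulrDl.
Qed.

Fact ass2_mulDr : right_distributive ass2_mul +%R.
Proof.
move=> a b c; apply: val_inj.
by rewrite /= malg_ofD !ass2_unlock /= malg_ofD mulrDr.
Qed.

Fact ass2_one_neq0 : ass2_one != 0.
Proof. by rewrite -(inj_eq val_inj) /= malg_of0 ass2_unlock /= oner_eq0. Qed.

HB.instance Definition _ := GRing.Zmodule_isNzRing.Build ass2
  ass2_mulA ass2_mul1 ass2_mulr1 ass2_mulDl ass2_mulDr ass2_one_neq0.

Lemma malg_of1 : malg_of 1 = 1.
Proof. exact: (congr1 malg_of ass2_one.unlock). Qed.

Lemma malg_ofM (a b : ass2) : malg_of (a * b) = malg_of a * malg_of b.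
Proof. exact: (congr1 (fun f => malg_of (f a b)) ass2_mul.unlock). Qed.

Fact ass2_scaleAl c (a b : ass2) : c *: (a * b) = (c *: a) * b.
Proof. by apply: val_inj; rewrite /= malg_ofZ !malg_ofM malg_ofZ scalerAl. Qed.

HB.instance Definition _ := GRing.Lmodule_isLalgebra.Build rat ass2 ass2_scaleAl.

Fact ass2_scaleAr c (a b : ass2) : c *: (a * b) = a * (c *: b).
Proof.
apply: val_inj; rewrite /= malg_ofZ !malg_ofM malg_ofZ; apply/malgP => w.
rewrite mcoeffZ [in LHS]mcoeffMl.
rewrite [RHS](mcoeffMlw _ (fsubset_refl _) (msuppZ_le c _)).
rewrite mulr_sumr; apply: eq_bigr => k _; rewrite mulr_sumr.
by apply: eq_bigr => l _; rewrite mcoeffZ mulrnAr mulrCA.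
Qed.

HB.instance Definition _ := GRing.Lalgebra_isAlgebra.Build rat ass2 ass2_scaleAr.

HB.lock Definition mono (s : seq bool) : ass2 := Ass2 << FMonom s >>.
HB.lock Definition coef (s : seq bool) (a : ass2) : rat := (malg_of a)@_(FMonom s).
Definition letter (i : bool) : ass2 := mono [:: i].
Definition gx : ass2 := letter false.
Definition gy : ass2 := letter true.

Lemma mono0 : mono [::] = 1.
Proof. by apply: val_inj; rewrite mono.unlock /= malg_of1 -fmoneE. Qed.

Lemma monoM s t : mono s * mono t = mono (s ++ t).
Proof.
apply: val_inj; rewrite mono.unlock /= malg_ofM /= malgM_def fgmulUU mulr1.
by congr (mkmalgU _ 1); exact: fmmulE.
Qed.

Lemma mono_rcons s i : mono (rcons s i) = mono s * letter i.
Proof. by rewrite monoM cats1. Qed.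

Lemma coefP a b : (forall s, coef s a = coef s b) -> a = b.
Proof.
move=> ab; apply/val_inj/malgP => w; rewrite -[w]fmK.
by have := ab w; rewrite coef.unlock.
Qed.

Fact coef_scalar s : scalar (coef s).
Proof. by move=> c a b; rewrite coef.unlock malg_ofD malg_ofZ mcoeffD mcoeffZ. Qed.

HB.instance Definition _ s := GRing.isLinear.Build rat ass2 rat *%R (coef s)
  (coef_scalar s).

Lemma coef_mono s t : coef s (mono t) = (t == s)%:R.
Proof. by rewrite coef.unlock mono.unlock /= mcoeffU fmP. Qed.

Lemma ass2_ind (P : ass2 -> Prop) :
  P 0 -> (forall c s a, P a -> P (c *: mono s + a)) -> forall a, P a.
Proof.
move=> P0 PD a.
have -> : a = \sum_(w <- msupp (malg_of a)) (malg_of a)@_w *: mono w.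
  apply: val_inj => /=; rewrite [LHS]monalgE.
  rewrite (big_morph malg_of malg_ofD malg_of0).
  apply: eq_bigr => w _; rewrite malg_ofZ mono.unlock /= fmK; apply/malgP => k.
  by rewrite mcoeffZ !mcoeffU mulr_natr.
elim: (msupp _ : seq _) => [|w s IHs]; first by rewrite big_nil.
by rewrite big_cons; apply: PD.
Qed.

Lemma eq_linear (V : lmodType rat) (f g : ass2 -> V) :
  linear f -> linear g -> (forall s, f (mono s) = g (mono s)) -> f =1 g.
Proof.
move=> lf lg fg; apply: ass2_ind => [|c s a IHa].
  have := lf (-1) 0 0; have := lg (-1) 0 0.
  by rewrite !scaleN1r oppr0 addr0 !addNr => -> ->.
by rewrite lf lg fg IHa.
Qed.

HB.lock Definition linext (h : seq bool -> ass2) (a : ass2) : ass2 :=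
  mmap (in_alg ass2) (fun w : {fmonom bool} => h w) (malg_of a).

Fact linext_linear h : linear (linext h).
Proof.
move=> c a b; rewrite linext.unlock malg_ofD malg_ofZ mmapD; congr (_ + _).
rewrite (mmapEw (msuppZ_le _ _)) mmapE scaler_sumr.
by apply: eq_bigr => w _; rewrite mcoeffZ !mulr_algl scalerA.
Qed.

HB.instance Definition _ h := GRing.isLinear.Build rat ass2 ass2 *:%R (linext h)
  (linext_linear h).

Lemma linextE h s : linext h (mono s) = h s.
Proof. by rewrite linext.unlock mono.unlock /= mmapU mulr_algl scale1r. Qed.

Definition hcomp (n : nat) : ass2 -> ass2 :=
  linext (fun s => if size s == n then mono s else 0).

HB.instance Definition _ n := GRing.Linear.copy (hcomp n) (linext _).

Lemma coef_hcomp n a s : coef s (hcomp n a) = if size s == n then coef s a else 0.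
Proof.
move: a; apply: ass2_ind => [|c t a IHa]; first by rewrite !linear0 if_same.
rewrite !linearP /= IHa /hcomp linextE coef_mono; case: (eqVneq t s) => [->|nts].
  by case: ifP => _; rewrite ?coef_mono ?eqxx // linear0 mulr0 addr0.
have -> : coef s (if size t == n then mono t else 0) = 0.
  by case: ifP => _; rewrite ?linear0 ?coef_mono ?(negPf nts).
by case: ifP => _; rewrite !mulr0 !add0r.
Qed.

Definition subst (p q : ass2) : ass2 -> ass2 :=
  linext (fun s => \prod_(i <- s) (if i then q else p)).

HB.instance Definition _ p q := GRing.Linear.copy (subst p q) (linext _).

Fact subst_monoid_morphism p q : monoid_morphism (subst p q).
Proof.
split=> [|a b]; first by rewrite /subst -mono0 linextE big_nil.
move: a; apply: eq_linear => [c a a'|c a a'|s].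
- by rewrite mulrDl -scalerAl linearP.
- by rewrite linearP mulrDl -scalerAl.
move: b; apply: eq_linear => [c b b'|c b b'|t].
- by rewrite mulrDr -scalerAr linearP.
- by rewrite linearP mulrDr -scalerAr.
by rewrite monoM /subst !linextE big_cat.
Qed.

HB.instance Definition _ p q :=
  GRing.isMonoidMorphism.Build ass2 ass2 (subst p q) (subst_monoid_morphism p q).

Lemma substX p q : subst p q gx = p.
Proof. by rewrite /subst linextE big_seq1. Qed.

Lemma substY p q : subst p q gy = q.
Proof. by rewrite /subst linextE big_seq1. Qed.

Definition iota2 : ass2 -> ass2 :=
  linext (fun s => (-1) ^+ size s *: mono (rev s)).

HB.instance Definition _ := GRing.Linear.copy iota2 (linext _).

Lemma iota2_1 : iota2 1 = 1.
Proof. by rewrite /iota2 -mono0 linextE scale1r. Qed.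

Lemma iota2_letter i : iota2 (letter i) = - letter i.
Proof. by rewrite /iota2 linextE expr1 scaleN1r. Qed.

Lemma iota2M a b : iota2 (a * b) = iota2 b * iota2 a.
Proof.
move: a; apply: eq_linear => [c a a'|c a a'|s].
- by rewrite mulrDl -scalerAl linearP.
- by rewrite linearP mulrDr -scalerAr.
move: b; apply: eq_linear => [c b b'|c b b'|t].
- by rewrite mulrDr -scalerAr linearP.
- by rewrite linearP mulrDl -scalerAl.
rewrite monoM /iota2 !linextE size_cat exprD rev_cat -monoM.
by rewrite -scalerAl -scalerAr scalerA mulrC.
Qed.

(* [d false] and [d true] are the partial derivatives in x and y, extended to all
   of [ass2] by ignoring the constant term: see [dE] and [d_uniq] below.  Lie
   elements have no constant term ([coef0_lie2]). *)

Definition dword (i : bool) (s : seq bool) : ass2 :=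
  if rev s is j :: t then (if j == i then mono (rev t) else 0) else 0.

Definition d (i : bool) : ass2 -> ass2 := linext (dword i).

HB.instance Definition _ i := GRing.Linear.copy (d i) (linext _).

Lemma d1 i : d i 1 = 0.
Proof. by rewrite /d -mono0 linextE. Qed.

Lemma dMletter i j a : d i (a * letter j) = if j == i then a else 0.
Proof.
move: a; apply: eq_linear => [c a b|c a b|s].
- by rewrite mulrDl -scalerAl linearP.
- by case: ifP => _ //; rewrite scaler0 addr0.
by rewrite -mono_rcons /d linextE /dword rev_rcons revK.
Qed.

Lemma d_letter i j : d i (letter j) = if j == i then 1 else 0.
Proof. by rewrite -[letter j]mul1r dMletter. Qed.

Lemma addr6 (a a' b b' c c' : ass2) :
  a + a' + (b + b') + (c + c') = a + b + c + (a' + b' + c').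
Proof. by rewrite (addrACA a) (addrACA (a + b)). Qed.

Lemma dE a : a = (coef [::] a)%:A + d false a * gx + d true a * gy.
Proof.
move: a; apply: eq_linear => [c a b //|c a b|s].
  rewrite !linearP /= !mulrDl scalerDl -scalerA -!scalerAl !scalerDr.
  exact: addr6.
case/lastP: s => [|s i].
  by rewrite mono0 !d1 !mul0r !addr0 -mono0 coef_mono eqxx scale1r.
rewrite coef_mono.
have -> : (rcons s i == [::]) = false by case: s.
rewrite scale0r add0r mono_rcons !dMletter; case: i => /=.
  by rewrite mul0r add0r.
by rewrite mul0r addr0.
Qed.

Lemma d_uniq a p q : a = p * gx + q * gy -> p = d false a /\ q = d true a.
Proof. by move=> ->; rewrite !linearD /= !dMletter /= addr0 add0r. Qed.

Notation dx := (d false).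
Notation dy := (d true).

Definition brk (a b : ass2) : ass2 := a * b - b * a.

(* The free Lie algebra on x and y, as the Lie subalgebra of [ass2] generated by
   x and y. *)
Inductive in_lie2 : ass2 -> Prop :=
| in_lie2_letter i : in_lie2 (letter i)
| in_lie2_lin c a b : in_lie2 a -> in_lie2 b -> in_lie2 (c *: a + b)
| in_lie2_brk a b : in_lie2 a -> in_lie2 b -> in_lie2 (brk a b).

Definition lie2_pred : {pred ass2} := [pred a | `[< in_lie2 a >]].

Fact lie2_submod_closed : submod_closed lie2_pred.
Proof.
split=> [|c a b].
  apply/asboolP; rewrite -(addNr gx) -scaleN1r.
  by apply: in_lie2_lin; apply: in_lie2_letter.
by move=> /asboolP la /asboolP lb; apply/asboolP; apply: in_lie2_lin.
Qed.

HB.instance Definition _ :=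
  GRing.isSubmodClosed.Build rat ass2 lie2_pred lie2_submod_closed.

Record lie2 : predArgType :=
  Lie2 { lie2_val :> ass2; lie2_valP : lie2_val \in lie2_pred }.

HB.instance Definition _ := [isSub for lie2_val].
HB.instance Definition _ := [Choice of lie2 by <:].
HB.instance Definition _ := [SubChoice_isSubLmodule of lie2 by <:].

Fact lie2_val_linear : linear lie2_val.
Proof. exact: (linearP (val : lie2 -> ass2)). Qed.

HB.instance Definition _ :=
  GRing.isLinear.Build rat lie2 ass2 *:%R lie2_val lie2_val_linear.

Lemma lie2P (a : lie2) : in_lie2 a.
Proof. exact/asboolP/lie2_valP. Qed.

Definition mk_lie2 a (la : in_lie2 a) : lie2 := Lie2 (introT (asboolP (in_lie2 a)) la).

Definition lx : lie2 := mk_lie2 (in_lie2_letter false).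
Definition ly : lie2 := mk_lie2 (in_lie2_letter true).
Definition lbrk (a b : lie2) : lie2 := mk_lie2 (in_lie2_brk (lie2P a) (lie2P b)).

Lemma lie2_elim (P : lie2 -> Prop) :
  P lx -> P ly -> (forall c a b, P a -> P b -> P (c *: a + b)) ->
  (forall a b, P a -> P b -> P (lbrk a b)) -> forall a, P a.
Proof.
move=> Px Py Plin Pbrk a.
suff IH b : in_lie2 b -> forall a, lie2_val a = b -> P a by apply: (IH _ (lie2P a)).
elim=> {a b} [i|c b b' lb IHb lb' IHb'|b b' lb IHb lb' IHb'] a ea.
- by case: i ea => ea; [have -> : a = ly|have -> : a = lx] => //; apply: val_inj.
- have -> : a = c *: mk_lie2 lb + mk_lie2 lb' by apply: val_inj.
  by apply: Plin; [apply: IHb|apply: IHb'].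
have -> : a = lbrk (mk_lie2 lb) (mk_lie2 lb') by apply: val_inj.
by apply: Pbrk; [apply: IHb|apply: IHb'].
Qed.

Fact lsubst_subproof (p q a : lie2) : in_lie2 (subst p q a).
Proof.
elim/lie2_elim: a => [||c a b IHa IHb|a b IHa IHb].
- by rewrite substX; apply: lie2P.
- by rewrite substY; apply: lie2P.
- by rewrite linearP; apply: in_lie2_lin.
by rewrite /= /brk rmorphB !rmorphM; apply: in_lie2_brk.
Qed.

Definition lsubst (p q a : lie2) : lie2 := mk_lie2 (lsubst_subproof p q a).

Lemma hcompM n (a b : ass2) :
  hcomp n (a * b) = \sum_(i < n.+1) hcomp i a * hcomp (n - i) b.
Proof.
move: a; apply: eq_linear => [c a a'|c a a'|s].
- by rewrite mulrDl -scalerAl linearP.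
- rewrite scaler_sumr -big_split; apply: eq_bigr => i _.
  by rewrite linearP mulrDl -scalerAl.
move: b; apply: eq_linear => [c b b'|c b b'|t].
- by rewrite mulrDr -scalerAr linearP.
- rewrite scaler_sumr -big_split; apply: eq_bigr => i _.
  by rewrite linearP mulrDr -scalerAr.
rewrite monoM /hcomp linextE size_cat.
under eq_bigr do rewrite !linextE.
case: (ltnP n (size s)) => [ltns|lesn].
  rewrite big1 => [|i _]; first by rewrite gtn_eqF // ltn_addr.
  have /gtn_eqF -> : (i < size s)%N by apply: leq_ltn_trans (leq_ord i) ltns.
  by rewrite mul0r.
have ltsn : (size s < n.+1)%N by [].
rewrite (bigD1 (Ordinal ltsn)) //= eqxx big1 => [|i nis].
  rewrite addr0 -[in LHS](subnKC lesn) eqn_add2l.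
  by case: ifP => _; rewrite ?mulr0 ?monoM.
case: eqP => [eis|_]; last by rewrite mul0r.
by case/eqP: nis; apply: val_inj.
Qed.

Fact lcomp_subproof n (a : lie2) : in_lie2 (hcomp n a).
Proof.
elim/lie2_elim: a n => [||c a b IHa IHb|a b IHa IHb] n.
- rewrite /= /gx /letter /hcomp linextE; case: ifP => _; first exact: in_lie2_letter.
  exact: lie2P 0.
- rewrite /= /gy /letter /hcomp linextE; case: ifP => _; first exact: in_lie2_letter.
  exact: lie2P 0.
- by rewrite linearP /=; apply: in_lie2_lin; [apply: IHa|apply: IHb].
rewrite /= /brk linearB /= !hcompM [X in _ - X](reindex_inj rev_ord_inj) /=.
rewrite -sumrB; elim/big_ind: _ => [|u v lu lv|i _]; first exact: lie2P 0.
  by rewrite -[u]scale1r; apply: in_lie2_lin.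
by rewrite subSS subKn ?leq_ord //; apply: in_lie2_brk.
Qed.

Definition lcomp (n : nat) (a : lie2) : lie2 := mk_lie2 (lcomp_subproof n a).
Definition pair_comp (n : nat) (p : lie2 * lie2) : lie2 * lie2 :=
  (lcomp n p.1, lcomp n p.2).

Definition R_spec (R : lie2 -> ass2) : Prop :=
  [/\ linear R, R lx = 0, R ly = 0
    & forall a b : lie2,
      R (lbrk a b) = brk (R a) b + brk a (R b)
        + dx b * gx * iota2 (dx a) - dx a * gx * iota2 (dx b)
        + dy b * gy * iota2 (dy a) - dy a * gy * iota2 (dy b)].

Lemma R_unique R1 R2 : R_spec R1 -> R_spec R2 -> R1 =1 R2.
Proof.
move=> [l1 x1 y1 b1] [l2 x2 y2 b2].
elim/lie2_elim => [||c a b IHa IHb|a b IHa IHb].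
- by rewrite x1 x2.
- by rewrite y1 y2.
- by rewrite l1 l2 IHa IHb.
by rewrite b1 b2 IHa IHb.
Qed.

(* An explicit formula for R: up to sign, remove one letter from every pair of
   equal consecutive letters of a word.  [Rrev] works on reversed words. *)
Fixpoint Rrev (s : seq bool) : ass2 :=
  if s is i :: t then Rrev t * letter i - d i (mono (rev t)) * letter i else 0.

Definition Rass : ass2 -> ass2 := linext (fun s => Rrev (rev s)).

HB.instance Definition _ := GRing.Linear.copy Rass (linext _).

Lemma RassMletter a i : Rass (a * letter i) = Rass a * letter i - d i a * letter i.
Proof.
move: a; apply: eq_linear => [c a b|c a b|s].
- by rewrite mulrDl -scalerAl linearP.
- by rewrite !linearP /= !mulrDl -!scalerAl opprD scalerBr addrACA.
by rewrite -mono_rcons /Rass !linextE rev_rcons /= revK.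
Qed.

Lemma Rass_letter i : Rass (letter i) = 0.
Proof. by rewrite -[letter i]mul1r RassMletter d1 /Rass -mono0 linextE !mul0r subrr. Qed.

Lemma coef0M (a b : ass2) : coef [::] (a * b) = coef [::] a * coef [::] b.
Proof.
move: a; apply: ass2_ind => [|c s a IHa]; first by rewrite mul0r !linear0 mul0r.
rewrite mulrDl -scalerAl !linearP /= IHa mulrDl -mulrA; congr (c * _ + _).
move: b {IHa}; apply: ass2_ind => [|e t b IHb].
  by rewrite mulr0 !linear0 mulr0.
rewrite mulrDr -scalerAr !linearP /= IHb mulrDr [RHS]addrC [LHS]addrC mulrCA.
congr (_ + e * _); rewrite monoM !coef_mono.
by case: s {IHb} => [|? ?]; case: t => [|? ?]; rewrite ?mulr1 ?mulr0.
Qed.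

Lemma coef0_lie2 (a : lie2) : coef [::] a = 0.
Proof.
elim/lie2_elim: a => [||c a b IHa IHb|a b IHa IHb].
- by rewrite /= coef_mono.
- by rewrite /= coef_mono.
- by rewrite linearP /= IHa IHb mulr0 addr0.
by rewrite /= /brk linearB /= !coef0M IHa mul0r mulr0 subrr.
Qed.

Lemma dM i (a b : ass2) : d i (a * b) = a * d i b + coef [::] b *: d i a.
Proof.
rewrite {1}[b]dE !mulrDr !linearD /= !mulrA !dMletter -scalerAr mulr1 linearZ /=.
by case: i; rewrite /= !addr0 addrC.
Qed.

Lemma iota2_lie2 (a : lie2) : iota2 a = - lie2_val a.
Proof.
elim/lie2_elim: a => [||c a b IHa IHb|a b IHa IHb].
- exact: iota2_letter.
- exact: iota2_letter.
- by rewrite lie2_val_linear linearP /= IHa IHb scalerN opprD.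
by rewrite /= /brk linearB /= !iota2M IHa IHb !mulrNN opprB.
Qed.

(* The correction term of R, antisymmetrized in the formula for R([a, b]). *)
Definition Rcor (a b : ass2) : ass2 :=
  dx a * gx * iota2 (dx b) + dy a * gy * iota2 (dy b).

Lemma RcorM (a : ass2) (b : lie2) c : Rcor (a * b) c = a * Rcor b c.
Proof. by rewrite /Rcor !dM coef0_lie2 !scale0r !addr0 mulrDr !mulrA. Qed.

Lemma Rcor_brk (a : ass2) (b c : lie2) : Rcor a (lbrk b c) = Rcor a b * c - Rcor a c * b.
Proof.
rewrite /Rcor /= /brk !linearB /= !dM !coef0_lie2 !scale0r !addr0.
rewrite !iota2M !iota2_lie2 !mulrBr !mulrN !opprK !mulrDl !mulrA opprD.
by rewrite addrACA addrC.
Qed.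

Lemma subr6 (u v w u' v' w' : ass2) :
  u + v - w - (u' + v' - w') = u - u' + (v - v') - (w - w').
Proof. by rewrite !opprD !opprK (addrACA (u + v)) (addrACA u). Qed.

Lemma RassM (a : ass2) (b : lie2) : Rass (a * b) = Rass a * b + a * Rass b - Rcor a b.
Proof.
elim/lie2_elim: b a => [||c b b' IHb IHb'|b b' IHb IHb'] a.
- rewrite RassMletter Rass_letter mulr0 addr0 /Rcor /=.
  rewrite !d_letter /=.
  by rewrite iota2_1 linear0 mulr0 addr0 mulr1.
- rewrite RassMletter Rass_letter mulr0 addr0 /Rcor /=.
  rewrite !d_letter /=.
  by rewrite iota2_1 linear0 mulr0 add0r mulr1.
- have -> : Rcor a (c *: b + b') = c *: Rcor a b + Rcor a b'.
    rewrite /Rcor !linearP /= !mulrDr -!scalerAr scalerDr.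
    by rewrite addrACA.
  rewrite /= !mulrDr -!scalerAr !linearP /= IHb IHb' !mulrDr -!scalerAr.
  by rewrite !scalerDr scalerN opprD -addr6.
have P (u v : lie2) : (forall a : ass2, Rass (a * u) = Rass a * u + a * Rass u - Rcor a u) ->
    (forall a : ass2, Rass (a * v) = Rass a * v + a * Rass v - Rcor a v) ->
    Rass (a * ((u : ass2) * v)) =
      Rass a * ((u : ass2) * v) + a * Rass ((u : ass2) * v) - Rcor a u * v.
  move=> IHu IHv; rewrite mulrA IHv IHu RcorM IHv.
  move: (Rcor a u) (Rcor u v) => S C; rewrite !mulrDl !mulNr !mulrDr !mulrN.
  by rewrite !mulrA -!addrA; congr (_ + (_ + _)); rewrite addrC -!addrA.
rewrite Rcor_brk /= /brk !mulrBr !(linearB Rass) /= mulrBr !P //.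
exact: subr6.
Qed.

Lemma Rass_spec : R_spec (fun a : lie2 => Rass a).
Proof.
split=> [c a b|||a b]; rewrite ?Rass_letter //; first exact: linearP.
rewrite /= {1}/brk linearB /= !RassM [in X in _ - X](addrC (Rass b * _)) subr6.
rewrite opprB /Rcor /brk -!addrA; do 5!congr (_ + _).
by rewrite opprD addrCA.
Qed.

(* By [R_unique], R is the only map satisfying [R_spec]. *)
Definition R_exists : {R : lie2 -> ass2 | R_spec R} := exist _ _ Rass_spec.
Definition R : lie2 -> ass2 := sval R_exists.

Lemma RE (a : lie2) : R a = Rass a.
Proof. by []. Qed.

Lemma RP : R_spec R.
Proof. exact: (svalP R_exists). Qed.

Definition grt1em : {pred lie2} := [pred phi : lie2 |
  [&& lsubst ly 0 phi - lsubst (lx + ly) 0 phi == 0,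
      dy phi + subst gy 0 (dy phi) - subst (gx + gy) 0 (dy phi) - R phi == 0
    & lbrk lx (lsubst ly lx phi) + lbrk ly phi == 0]].

Definition comm_span : {pred ass2} := [pred a | `[< exists s : seq (rat * (ass2 * ass2)),
  a = \sum_(t <- s) t.1 *: brk t.2.1 t.2.2 >]].

Fact comm_span_zmod_closed : zmod_closed comm_span.
Proof.
split=> [|a b]; first by apply/asboolP; exists [::]; rewrite big_nil.
move=> /asboolP [s ->] /asboolP [t ->]; apply/asboolP.
exists (s ++ [seq (- u.1, u.2) | u <- t]).
rewrite big_cat big_map; congr (_ + _); rewrite -sumrN.
by apply: eq_bigr => u _; rewrite scaleNr.
Qed.

HB.instance Definition _ :=
  GRing.isZmodClosed.Build ass2 comm_span comm_span_zmod_closed.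

Notation tr2 := (Quotient.quot comm_span).
Definition tr (a : ass2) : tr2 := \pi_tr2%qT a.

(* Power series are given by their coefficients, and an equality in the degree
   completion of [tr2] (the product of its homogeneous components) is an
   equality in each degree. *)
Definition krv2 : {pred lie2 * lie2} := [pred p : lie2 * lie2 | `[<
  lbrk lx p.1 + lbrk ly p.2 = 0 /\
  exists f0 f1 f2 : nat -> rat, forall n : nat,
    tr (hcomp n (gx * dx p.1 + gy * dy p.2)) =
    tr (f0 n *: (gx + gy) ^+ n + f1 n *: gx ^+ n + f2 n *: gy ^+ n) >]].

Definition krv2sym : {pred lie2 * lie2} :=
  [pred p : lie2 * lie2 | (p \in krv2) && (p.2 == lsubst ly lx p.1)].

Definition krv2sym_ge2 : {pred lie2 * lie2} :=
  [pred p : lie2 * lie2 | [&& p \in krv2sym, pair_comp 0%N p == 0 & pair_comp 1%N p == 0]].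

Definition nu_em (phi : lie2) : lie2 * lie2 := (lsubst ly lx phi, phi).

(* In the next two definitions, [c n], [cV n] and [cW n] stand for the projections
   onto the components of degree n. *)

Definition graded_subspace (V : lmodType rat) (c : nat -> V -> V) (A : {pred V}) :=
  submod_closed A /\ forall n, {in A, forall v, c n v \in A}.

Definition graded_linear_iso (V W : lmodType rat) (cV : nat -> V -> V)
    (cW : nat -> W -> W) (A : {pred V}) (B : {pred W}) (f : V -> W) : Prop :=
  [/\ graded_subspace cV A /\ graded_subspace cW B,
      forall k : rat, {in A &, forall u v, f (k *: u + v) = k *: f u + f v},
      forall n, {in A, forall v, f (cV n v) = cW n (f v)},
      {in A, forall v, f v \in B}
    & {in A &, injective f} /\ {in B, forall w, exists2 v, v \in A & f v = w}].

(* Main.v *)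
From HB Require Import structures.
Require Import Defs.
From mathcomp Require Import all_boot all_order all_algebra.
From mathcomp Require Import boolp.

Set Implicit Arguments.
Unset Strict Implicit.
Unset Printing Implicit Defensive.

Import GRing.Theory Num.Theory.

Local Open Scope ring_scope.

(** Everything is read off from coefficients of words.  For [phi] a Lie element,
    put [u(x,y) = phi(y,x)] and [omega = x u + y phi].

    The equation [[x,u] + [y,phi] = 0] says [x u + y phi = u x + phi y], that is,
    that the coefficients of [omega] do not change when a word is rotated
    ([rot_inv_omega]).  Grant this, and let [E(s)] be the sum of the coefficients
    of [omega] at the words obtained from [s] by doubling one letter ([dup_sum]).
    Both remaining conditions are conditions on [E] alone.

    - R removes, with a minus sign, one letter from each pair of equal consecutive
      letters; dually, the coefficient of [R phi] at [t] is minus the sum of the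
      coefficients of [phi] at [t] with one letter doubled ([coef_Rass]).  Doubling
      a letter of [t] is doubling a letter of [y t] other than the first, and
      doubling the first one gives [y y t], a rotation of [y t y], whose
      coefficient in [omega] is that of [dy phi] at [t].  So [dy phi - R phi] has
      coefficient [E(y t)] at [t] ([dup_sum_omega_y]).  With [alpha] the coefficient
      of [x^(n-1) y] in [phi] and [n] the length of [y t], the second defining
      equation becomes [E(y t) = alpha (1 - [y t = y^n])].  As [omega] is symmetric
      under exchanging x and y, the same holds for words [x t], and in all:
      [E(s) = alpha (1 - [s = x^n] - [s = y^n])]  ([grt1emP]).

    - An identity in [tr2] can be tested, in characteristic 0, by summing the
      coefficients over all rotations of each word ([tr_eqP]).  For the divergence
      [x dx u + y dy phi], a word [i t] contributes the coefficient of [omega] at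
      [i t i], equal to that at [i i t]; so the cyclic sum at [s] is again [E(s)]
      ([cyc_sum_div]), and the divergence condition says
      [E(s) = n (f0 + f1 [s = x^n] + f2 [s = y^n])]  ([krv2P]).

    Hence [f0 = alpha / n], [f1 = f2 = - alpha / n] turns the first condition into
    the second.  Conversely, in degree [n >= 2] the constants are forced: [E(x^n)]
    and [E(y^n)] vanish because Lie elements contain no powers of a letter
    ([coef_pow_lie2]), and [E(y x^(n-1)) = alpha].  In degree 1 both conditions
    force the Lie element to vanish, on the Kashiwara-Vergne side by truncation.
    So the symmetric pairs of degree at least 2 are exactly the images of [nu_em]
    ([krv2sym_ge2P]), and [nu_em] is injective, its second component being the
    identity. *)

(** * Coefficients of products, substitutions and Lie elements *)

Lemma eq_functional (f g : ass2 -> rat) :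
  scalar f -> scalar g -> (forall s, f (mono s) = g (mono s)) -> f =1 g.
Proof. exact: (@eq_linear rat^o). Qed.

Lemma coef_nil_lM i a : coef [::] (letter i * a) = 0.
Proof. by rewrite Defs.coef0M coef_mono mul0r. Qed.

Lemma coef_nil_rM i a : coef [::] (a * letter i) = 0.
Proof. by rewrite Defs.coef0M coef_mono mulr0. Qed.

Lemma coef_consM i j s a :
  coef (i :: s) (letter j * a) = (i == j)%:R * coef s a.
Proof.
move: a; apply: eq_functional => [c a b|c a b|t].
- by rewrite mulrDr -scalerAr linearP.
- by rewrite linearP mulrDr mulrCA.
by rewrite monoM /= !coef_mono eqseq_cons eq_sym -natrM mulnb.
Qed.

Lemma coef_rconsM i j s a :
  coef (rcons s i) (a * letter j) = (i == j)%:R * coef s a.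
Proof.
move: a; apply: eq_functional => [c a b|c a b|t].
- by rewrite mulrDl -scalerAl linearP.
- by rewrite linearP mulrDr mulrCA.
by rewrite -mono_rcons !coef_mono eqseq_rcons (eq_sym j) -natrM mulnb andbC.
Qed.

Lemma coef_d i s a : coef s (d i a) = coef (rcons s i) a.
Proof.
rewrite [in RHS](dE a) !linearD linearZ /= -mono0 coef_mono.
have -> : ([::] == rcons s i) = false by case: s.
by rewrite mulr0 add0r !coef_rconsM; case: i; rewrite !(mul0r, mul1r, addr0, add0r).
Qed.

Lemma coef_swap s a : coef s (subst gy gx a) = coef (map negb s) a.
Proof.
move: a; apply: eq_functional => [c a b|c a b|t]; try exact: linearP.
  by rewrite !linearP.
rewrite coef_mono /subst linextE.
have -> : \prod_(i <- t) (if i then gx else gy) = mono (map negb t).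
  elim: t => [|i t IHt]; first by rewrite big_nil mono0.
  by rewrite big_cons IHt; case: i; rewrite monoM.
by rewrite coef_mono -(inj_eq (inj_map negb_inj)) (mapK negbK).
Qed.

(** Substituting 0 for y keeps only the powers of x, and the n-th power of a linear
    form expands into all words of length n, weighted by the products of its
    coefficients. *)
Lemma coef_subst_l (c : bool -> rat) p :
  p = c false *: gx + c true *: gy ->
  forall s a, coef s (subst p 0 a) =
    (\prod_(i <- s) c i) * coef (nseq (size s) false) a.
Proof.
move=> defp s a; move: a; apply: eq_functional => [e a b|e a b|t].
- by rewrite !linearP.
- by rewrite linearP mulrDr mulrCA.
rewrite /subst linextE coef_mono.
elim: t s => [|i t IHt] s.
  rewrite big_nil -mono0 coef_mono; case: s => [|j s]; last by rewrite mulr0.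
  by rewrite big_nil mulr1.
rewrite big_cons; case: i => /=.
  by rewrite mul0r linear0; case: s => [|j s]; rewrite mulr0.
rewrite {1}defp mulrDl -!scalerAl linearD !linearZ /=.
case: s => [|i s]; first by rewrite !coef_nil_lM !mulr0 addr0.
rewrite !coef_consM IHt big_cons /= eqseq_cons eqxx.
by case: i; rewrite /= !(mul0r, mulr0, mul1r, addr0, add0r) mulrA.
Qed.

Lemma prod_indicator i (s : seq bool) :
  \prod_(j <- s) (j == i)%:R = (all (pred1 i) s)%:R :> rat.
Proof.
elim: s => [|j s IHs]; first by rewrite big_nil.
by rewrite big_cons IHs -natrM mulnb.
Qed.

Lemma coef_subst_gy s a :
  coef s (subst gy 0 a) = (all (pred1 true) s)%:R * coef (nseq (size s) false) a.
Proof.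
rewrite (@coef_subst_l (fun j => (j == true)%:R)) ?prod_indicator //.
by rewrite /= scale0r add0r scale1r.
Qed.

Lemma coef_subst_gxDgy s a :
  coef s (subst (gx + gy) 0 a) = coef (nseq (size s) false) a.
Proof.
rewrite (@coef_subst_l (fun=> 1)) ?big1 ?mul1r //.
by rewrite !scale1r.
Qed.

Lemma letterX i n : letter i ^+ n = mono (nseq n i).
Proof. by elim: n => [|n IHn]; rewrite ?expr0 ?mono0 // exprS IHn monoM. Qed.

Lemma coef_letterX i n s :
  size s = n -> coef s (letter i ^+ n) = (all (pred1 i) s)%:R.
Proof.
move=> <-; rewrite letterX coef_mono eq_sym; congr (nat_of_bool _)%:R.
exact/eqP/all_pred1P.
Qed.

Lemma coef_gxDgyX n s : coef s ((gx + gy) ^+ n) = (size s == n)%:R.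
Proof.
have -> : (gx + gy) ^+ n = subst (gx + gy) 0 (gx ^+ n).
  by rewrite rmorphXn /= substX.
rewrite coef_subst_gxDgy letterX coef_mono.
congr (nat_of_bool _)%:R; apply/eqP/eqP => [/(congr1 size)|-> //].
by rewrite !size_nseq.
Qed.

(** The products [s t] and [t s] of two words are powers of a letter at the same
    time. *)
Lemma coef_pow_brk i n a b : coef (nseq n i) (brk a b) = 0.
Proof.
rewrite /brk linearB /=; apply/eqP; rewrite subr_eq0; apply/eqP.
move: a; apply: eq_functional => [c a a'|c a a'|s].
- by rewrite mulrDl -scalerAl linearP.
- by rewrite mulrDr -scalerAr linearP.
move: b; apply: eq_functional => [c b b'|c b b'|t].
- by rewrite mulrDr -scalerAr linearP.
- by rewrite mulrDl -scalerAl linearP.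
rewrite !monoM !coef_mono; congr (nat_of_bool _)%:R.
have eq_nseq w : (w == nseq n i) = (size w == n) && all (pred1 i) w.
  apply/eqP/andP => [->|[/eqP <- /all_pred1P //]].
  by rewrite size_nseq all_pred1_nseq.
by rewrite !eq_nseq !size_cat !all_cat addnC [X in _ && X]andbC.
Qed.

Lemma coef_pow_lie2 i n (a : lie2) : n != 1%N -> coef (nseq n i) a = 0.
Proof.
move=> n1; elim/lie2_elim: a => [||c a b IHa IHb|a b IHa IHb].
- by rewrite /= coef_mono; case: n n1 => [|[|n]] // _; rewrite eqseq_cons andbF.
- by rewrite /= coef_mono; case: n n1 => [|[|n]] // _; rewrite eqseq_cons andbF.
- by rewrite linearP /= IHa IHb mulr0 addr0.
exact: coef_pow_brk.
Qed.

(** * Doubling a letter *)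

Definition dup (j : nat) (s : seq bool) := take j.+1 s ++ drop j s.

Lemma dup_cat p i q : dup (size p) (p ++ i :: q) = p ++ i :: i :: q.
Proof.
rewrite /dup drop_size_cat // -(cat_rcons i p q) take_size_cat ?size_rcons //.
by rewrite cat_rcons.
Qed.

Lemma dup_rcons j s k : (j < size s)%N -> dup j (rcons s k) = rcons (dup j s) k.
Proof. by move=> ltj; rewrite /dup -!cats1 takel_cat // drop_cat ltj catA. Qed.

Lemma word_split j (s : seq bool) : (j < size s)%N ->
  exists2 pq : seq bool * seq bool, size pq.1 = j & exists i, s = pq.1 ++ i :: pq.2.
Proof.
move=> ltj; exists (take j s, drop j.+1 s); first by rewrite size_takel // ltnW.
by exists (nth false s j); rewrite -drop_nth // cat_take_drop.
Qed.

Lemma map_dup f j s : map f (dup j s) = dup j (map f s).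
Proof. by rewrite /dup map_cat map_take map_drop. Qed.

Lemma size_dup j s : (j < size s)%N -> size (dup j s) = (size s).+1.
Proof.
by case/word_split=> -[p q] /= <- [i ->]; rewrite dup_cat !size_cat /= !addnS.
Qed.

(** For [a = x u + y v] with rotation-invariant coefficients this is both the cyclic
    sum of the divergence of [(u, v)] ([cyc_sum_div]) and, at words starting with y,
    the coefficient of [dy v - R v] ([dup_sum_omega_y]). *)
Definition dup_sum (s : seq bool) (a : ass2) := \sum_(j < size s) coef (dup j s) a.

(** R deletes the first letter of each pair of equal consecutive letters; the words
    from which [s] arises in this way are its doublings, each with the position of
    the doubled letter. *)
Lemma coef_Rass s a : coef s (Rass a) = - dup_sum s a.
Proof.
rewrite /dup_sum.
move: a s; suff P t s : coef s (Rass (mono t)) =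
    - \sum_(j < size s) coef (dup j s) (mono t).
  move=> a s; move: a; apply: eq_functional => // [c a b|c a b].
    by rewrite !linearP.
  rewrite mulrN mulr_sumr -opprD -big_split; congr (- _).
  by apply: eq_bigr => j _; rewrite linearP.
elim/last_ind: t s => [|t i IHt] s.
  rewrite /Rass linextE linear0 big1 ?oppr0 // => j _; rewrite coef_mono.
  by rewrite (introF eqP) // => /(congr1 size); rewrite size_dup.
rewrite mono_rcons RassMletter -mulrBl; case/lastP: s => [|s k].
  by rewrite coef_nil_rM big_ord0 oppr0.
rewrite coef_rconsM linearB /= coef_d IHt size_rcons big_ord_recr /=.
rewrite -[in dup (size s) _]cats1 dup_cat.
have -> : s ++ [:: k; k] = rcons (rcons s k) k by rewrite -!cats1 -catA.
rewrite coef_rconsM mulrBr mulrN opprD mulr_sumr; congr (- _ - _).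
  by apply: eq_bigr => j _; rewrite dup_rcons // coef_rconsM.
by case: eqVneq => [->|]; rewrite ?mul0r.
Qed.

(** * Cyclic sums *)

(** These are the linear functionals that factor through [tr2]: in characteristic 0
    they separate its elements of positive degree ([tr_eqP]). *)
Definition cyc_sum (s : seq bool) (a : ass2) := \sum_(j < size s) coef (rot j s) a.

Fact cyc_sum_scalar s : scalar (cyc_sum s).
Proof.
move=> c a b; rewrite /cyc_sum mulr_sumr -big_split; apply: eq_bigr => j _.
exact: linearP.
Qed.

HB.instance Definition _ s := GRing.isLinear.Build rat ass2 rat *%R (cyc_sum s)
  (cyc_sum_scalar s).

Lemma sum_rotS (F : seq bool -> rat) s :
  \sum_(j < size s) F (rot j.+1 s) = \sum_(j < size s) F (rot j s).
Proof.
case: s => [|i s]; first by rewrite !big_ord0.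
rewrite big_ord_recr [RHS]big_ord_recl /= rot0 addrC.
by rewrite -[(size s).+1]/(size (i :: s)) rot_size.
Qed.

Lemma cyc_sum_rot s k w : cyc_sum s (mono (rot k w)) = cyc_sum s (mono w).
Proof.
have cyc_sum_rot1 v : cyc_sum s (mono (rot 1 v)) = cyc_sum s (mono v).
  rewrite /cyc_sum -(sum_rotS (fun t => coef t (mono (rot 1 v)))).
  by apply: eq_bigr => j _; rewrite rotS // !coef_mono (inj_eq (@rot_inj 1 bool)).
case: (leqP k (size w)) => [|/ltnW/rot_oversize -> //].
elim: k => [|k IHk] lekw; first by rewrite rot0.
by rewrite rotS // cyc_sum_rot1 IHk // ltnW.
Qed.

Lemma cyc_sum_brk s a b : cyc_sum s (brk a b) = 0.
Proof.
rewrite /brk linearB /=; apply/eqP; rewrite subr_eq0; apply/eqP.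
move: a; apply: eq_functional => [c a a'|c a a'|u].
- by rewrite mulrDl -scalerAl linearP.
- by rewrite mulrDr -scalerAr linearP.
move: b; apply: eq_functional => [c b b'|c b b'|v].
- by rewrite mulrDr -scalerAr linearP.
- by rewrite mulrDl -scalerAl linearP.
by rewrite !monoM -[v ++ u](rot_size_cat u v) cyc_sum_rot.
Qed.

Lemma comm_span_brk a b : brk a b \in comm_span.
Proof. by apply/asboolP; exists [:: (1, (a, b))]; rewrite big_seq1 scale1r. Qed.

Lemma comm_span_scale c a : a \in comm_span -> c *: a \in comm_span.
Proof.
move=> /asboolP [s ->]; apply/asboolP; exists [seq (c * t.1, t.2) | t <- s].
by rewrite big_map scaler_sumr; apply: eq_bigr => t _; rewrite scalerA.
Qed.

Lemma cyc_sum_comm_span s a : a \in comm_span -> cyc_sum s a = 0.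
Proof.
move=> /asboolP [r ->]; rewrite linear_sum big1 // => t _.
by rewrite linearZ /= cyc_sum_brk mulr0.
Qed.

(** Rotating a word [p q] into [q p] changes it by a commutator. *)
Lemma comm_span_sub_rot k a :
  a - linext (fun s => mono (rotr k s)) a \in comm_span.
Proof.
move: a; apply: ass2_ind => [|c s a IHa]; first by rewrite linear0 subrr rpred0.
rewrite linearP /= linextE opprD addrACA -scalerBr rpredD ?comm_span_scale //.
rewrite /rotr /rot; set j := (size s - k)%N.
rewrite -[in mono s](cat_take_drop j s) -!monoM.
exact: comm_span_brk.
Qed.

(** Modulo commutators, [n a] is the sum of the [n] rotations of [a], whose
    coefficients are the cyclic sums of [a]. *)
Lemma comm_span_cyc_sum n a : (0 < n)%N ->
    (forall s, size s != n -> coef s a = 0) ->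
    (forall s, size s = n -> cyc_sum s a = 0) ->
  a \in comm_span.
Proof.
move=> n_gt0 a_n cyc0; pose r k := linext (fun s => mono (rotr k s)).
have coef_r k s : coef s (r k a) = coef (rot k s) a.
  move: a {a_n cyc0}; apply: eq_functional => [c a b|c a b|t].
  - by rewrite /r !linearP.
  - exact: linearP.
  by rewrite /r linextE !coef_mono -(inj_eq (@rot_inj k bool)) rotrK.
have sum0 : \sum_(k < n) r k a = 0.
  apply: Defs.coefP => s; rewrite linear_sum linear0 /=.
  under eq_bigr do rewrite coef_r.
  case: (eqVneq (size s) n) => [sn|sn].
    by have := cyc0 s sn; rewrite /cyc_sum sn.
  by rewrite big1 // => k _; rewrite a_n // size_rot.
have -> : a = n%:R^-1 *: \sum_(k < n) (a - r k a).
  rewrite sumrB sum0 subr0 sumr_const card_ord -scaler_nat scalerA mulVf ?scale1r //.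
  by rewrite pnatr_eq0 -lt0n.
by apply: comm_span_scale; apply: rpred_sum => k _; apply: comm_span_sub_rot.
Qed.

Lemma tr_eqE a b : (tr a = tr b) <-> (a - b \in comm_span).
Proof. by rewrite Quotient.idealrBE; split=> [/eqP|/eqP]. Qed.

Lemma tr_eqP n a b : (0 < n)%N ->
    (forall s, size s != n -> coef s a = 0) ->
    (forall s, size s != n -> coef s b = 0) ->
  (tr a = tr b) <-> (forall s, size s = n -> cyc_sum s a = cyc_sum s b).
Proof.
move=> n_gt0 a_n b_n; rewrite tr_eqE; split=> [ab s _|ab].
  by apply/eqP; rewrite -subr_eq0 -(linearB (cyc_sum s)) /= cyc_sum_comm_span.
apply: (comm_span_cyc_sum n_gt0) => s sn; rewrite linearB /=.
  by rewrite a_n // b_n // subr0.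
by rewrite ab // subrr.
Qed.

(** * Rotation-invariant elements and the divergence *)

Definition rot_inv (a : ass2) := forall s, coef (rot 1 s) a = coef s a.

Lemma rot_inv_catC a s t : rot_inv a -> coef (s ++ t) a = coef (t ++ s) a.
Proof.
move=> inv_a; elim: s t => [|i s IHs] t; first by rewrite cats0.
by rewrite cat_cons -inv_a rot1_cons rcons_cat IHs cat_rcons.
Qed.

Definition omega (u v : ass2) := gx * u + gy * v.

Lemma coef_omega_nil u v : coef [::] (omega u v) = 0.
Proof. by rewrite linearD /= !coef_nil_lM addr0. Qed.

Lemma coef_omega i s u v :
  coef (i :: s) (omega u v) = coef s (if i then v else u).
Proof.
rewrite linearD /= !coef_consM.
by case: i; rewrite !(mul0r, mul1r, addr0, add0r).
Qed.

(** [[x,u] + [y,v] = 0] says [x u + y v = u x + v y]; the two sides read the same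
    coefficients of [u] and [v] off the first letter of a word and off its last
    letter. *)
Lemma rot_inv_omega u v :
  (brk gx u + brk gy v = 0) <-> rot_inv (omega u v).
Proof.
have coef_omegar i s : coef (rcons s i) (u * gx + v * gy) = coef (i :: s) (omega u v).
  rewrite linearD /= !coef_rconsM coef_omega.
  by case: i; rewrite !(mul0r, mul1r, addr0, add0r).
have -> : brk gx u + brk gy v = omega u v - (u * gx + v * gy).
  by rewrite /brk addrACA -opprD.
split=> [/subr0_eq eq_uv [|i s] //|inv].
  by rewrite rot1_cons [in LHS]eq_uv coef_omegar.
apply/eqP; rewrite subr_eq0; apply/eqP/Defs.coefP => s.
case/lastP: s => [|s i].
  by rewrite coef_omega_nil linearD /= !coef_nil_rM addr0.
by rewrite coef_omegar -[RHS]inv rot1_cons.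
Qed.

(** At [i t] the divergence has the coefficient of [omega] at [i t i], hence that at
    [i i t]: the first letter is doubled.  Doubling the first letter of the j-th
    rotation of [s] is a rotation of [s] with its j-th letter doubled. *)
Lemma cyc_sum_div u v s : rot_inv (omega u v) ->
  cyc_sum s (gx * dx u + gy * dy v) = dup_sum s (omega u v).
Proof.
move=> inv; apply: eq_bigr => -[j] /= ltj _.
have [[p q] /= <- [i ->]] := word_split ltj.
rewrite rot_size_cat dup_cat [RHS]rot_inv_catC //=.
rewrite -[RHS]inv rot1_cons /= -/(omega (dx u) (dy v)) !coef_omega.
by case: i; rewrite coef_d.
Qed.

(** Doubling the first letter of [y t] gives a rotation of [y t y], which yields
    [dy v]; doubling another letter acts inside [t], which yields [- R v]. *)
Lemma dup_sum_omega_y u v t : rot_inv (omega u v) ->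
  dup_sum (true :: t) (omega u v) = coef t (dy v) - coef t (Rass v).
Proof.
move=> inv; rewrite coef_Rass opprK /dup_sum big_ord_recl /=.
rewrite /dup /= take0 /= -inv rot1_cons /= !coef_omega coef_d; congr (_ + _).
by apply: eq_bigr => j _; rewrite coef_omega.
Qed.

(** * The divergence condition in coefficients *)

(** The coefficient of [s] in [f0 (x + y)^n + f1 x^n + f2 y^n], for [s] of length n. *)
Definition power_profile (f0 f1 f2 : rat) (s : seq bool) : rat :=
  f0 + f1 * (all (pred1 false) s)%:R + f2 * (all (pred1 true) s)%:R.

Lemma coef_powers f0 f1 f2 n s :
  coef s (f0 *: (gx + gy) ^+ n + f1 *: gx ^+ n + f2 *: gy ^+ n)
  = if size s == n then power_profile f0 f1 f2 s else 0.
Proof.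
rewrite !linearD !linearZ /= coef_gxDgyX.
case: eqP => [sn|sn]; first by rewrite !coef_letterX // mulr1.
have coef0 i : coef s (letter i ^+ n) = 0.
  rewrite letterX coef_mono; case: eqP => // /(congr1 size).
  by rewrite size_nseq => /esym.
by rewrite !coef0 !mulr0 !addr0.
Qed.

Lemma cyc_sum_powers f0 f1 f2 s :
  cyc_sum s (f0 *: (gx + gy) ^+ size s + f1 *: gx ^+ size s + f2 *: gy ^+ size s)
    = (size s)%:R * power_profile f0 f1 f2 s.
Proof.
rewrite /cyc_sum.
under eq_bigr do
  rewrite coef_powers size_rot eqxx /power_profile !(eq_all_r (mem_rot _ _)).
by rewrite sumr_const card_ord mulr_natl.
Qed.

(** The condition in degree 0 is void: the divergence has no constant term, and the
    power series can be chosen without one. *)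
Lemma krv2P p : (p \in krv2) <-> rot_inv (omega p.1 p.2) /\
  exists f0 f1 f2 : nat -> rat, forall s, (0 < size s)%N ->
    dup_sum s (omega p.1 p.2) =
      (size s)%:R * power_profile (f0 (size s)) (f1 (size s)) (f2 (size s)) s.
Proof.
case: p => u v /=; set D := gx * dx u + gy * dy v.
have supp_hcomp n s : size s != n -> coef s (hcomp n D) = 0.
  by move=> sn; rewrite coef_hcomp (negPf sn).
have supp_powers f0 f1 f2 n s : size s != n ->
    coef s (f0 *: (gx + gy) ^+ n + f1 *: gx ^+ n + f2 *: gy ^+ n) = 0.
  by move=> sn; rewrite coef_powers (negPf sn).
have cyc_D s : rot_inv (omega u v) ->
    cyc_sum s (hcomp (size s) D) = dup_sum s (omega u v).
  move=> inv; rewrite -cyc_sum_div //; apply: eq_bigr => j _.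
  by rewrite coef_hcomp size_rot eqxx.
split.
  move=> /asboolP [/(congr1 lie2_val)]; rewrite linearD linear0 /=.
  move=> /rot_inv_omega inv [f0 [f1 [f2 trD]]]; split=> //.
  exists f0, f1, f2 => s s_gt0; rewrite -cyc_D // -cyc_sum_powers.
  exact: (tr_eqP s_gt0 (@supp_hcomp _) (@supp_powers _ _ _ _)).1.
case=> inv [f0 [f1 [f2 sumD]]]; apply/asboolP; split.
  by apply: val_inj; rewrite linearD linear0; apply/rot_inv_omega.
(* The given power series may have constant terms, which no word of positive
   length constrains. *)
pose cut (f : nat -> rat) n := if n is 0 then 0 else f n.
exists (cut f0), (cut f1), (cut f2) => -[|n].
  rewrite !scale0r !addr0; congr tr; apply: Defs.coefP => s.
  rewrite coef_hcomp linear0; case: s => [|//].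
  by rewrite /= linearD /= !coef_nil_lM addr0.
apply: (tr_eqP (ltn0Sn n) (@supp_hcomp _) (@supp_powers _ _ _ _)).2 => s sn.
by rewrite /= -/D -[in LHS]sn cyc_D // sumD ?sn // -sn cyc_sum_powers sn.
Qed.

Lemma dup_sum_nseq n i a : dup_sum (nseq n i) a = n%:R * coef (nseq n.+1 i) a.
Proof.
rewrite /dup_sum size_nseq (eq_bigr (fun=> coef (nseq n.+1 i) a)) => [|j _].
  by rewrite sumr_const card_ord mulr_natl.
by rewrite /dup take_nseq // drop_nseq -nseqD addSn subnKC // ltnW.
Qed.

(** * Symmetric pairs *)

Lemma lsubst_swapK : involutive (lsubst ly lx).
Proof.
move=> a; apply: val_inj; apply: Defs.coefP => s.
by rewrite /= !coef_swap (mapK negbK).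
Qed.

Definition swap_omega (a : ass2) := omega (subst gy gx a) a.

Fact swap_omega_linear : linear swap_omega.
Proof.
move=> c a b; rewrite /swap_omega /omega linearP !mulrDr -!scalerAr scalerDr.
exact: addrACA.
Qed.

HB.instance Definition _ :=
  GRing.isLinear.Build rat ass2 ass2 *:%R swap_omega swap_omega_linear.

Lemma coef_swap_omega_hcomp n a s :
  coef s (swap_omega (hcomp n a)) = if size s == n.+1 then coef s (swap_omega a) else 0.
Proof.
case: s => [|i s]; first by rewrite !coef_omega_nil.
rewrite !coef_omega; case: i; rewrite ?coef_swap coef_hcomp ?size_map //.
Qed.

Lemma dup_sum_swap (phi : lie2) s :
  dup_sum (map negb s) (swap_omega phi)
    = dup_sum s (swap_omega phi).
Proof.
rewrite /dup_sum size_map; apply: eq_bigr => j _; rewrite -map_dup.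
case: (dup j s) => [|[] t] //=; rewrite !coef_omega coef_swap //.
by rewrite (mapK negbK).
Qed.

(** Both substitutions see only the powers of x in [phi], and x itself is the only
    one that a Lie element can contain. *)
Lemma grt1em_no_xP (phi : lie2) :
  (lsubst ly 0 phi - lsubst (lx + ly) 0 phi = 0) <-> (coef [:: false] phi = 0).
Proof.
have valE : lie2_val (lsubst ly 0 phi - lsubst (lx + ly) 0 phi)
    = subst gy 0 phi - subst (gx + gy) 0 phi.
  by rewrite linearB; congr (_ - _).
split=> [/(congr1 lie2_val)|phi0]; rewrite ?valE.
  move/(congr1 (coef [:: false])); rewrite !linear0 linearB /=.
  rewrite coef_subst_gy coef_subst_gxDgy /= mul0r sub0r.
  by move/eqP; rewrite oppr_eq0 => /eqP.
apply: val_inj; rewrite [LHS]valE [RHS]linear0; apply: Defs.coefP => s.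
rewrite linearB linear0 /= coef_subst_gy coef_subst_gxDgy.
have -> : coef (nseq (size s) false) phi = 0; last by rewrite mulr0 subrr.
by have [->|s1] := eqVneq (size s) 1%N; [exact: phi0|exact: coef_pow_lie2].
Qed.

(** The equation itself only concerns words starting with y; the words starting with
    x are covered by the symmetry of [swap_omega phi]. *)
Lemma grt1em_dyP (phi : lie2) : rot_inv (swap_omega phi) ->
  (dy phi + subst gy 0 (dy phi) - subst (gx + gy) 0 (dy phi) - R phi = 0) <->
  (forall s, (0 < size s)%N -> dup_sum s (swap_omega phi) =
     coef (rcons (nseq (size s).-1 false) true) phi * power_profile 1 (-1) (-1) s).
Proof.
move=> inv.
have coef_eq t :
  coef t (dy phi + subst gy 0 (dy phi) - subst (gx + gy) 0 (dy phi) - R phi)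
   = dup_sum (true :: t) (swap_omega phi)
     - coef (rcons (nseq (size t) false) true) phi
       * power_profile 1 (-1) (-1) (true :: t).
  rewrite dup_sum_omega_y // !linearB linearD /= coef_subst_gy coef_subst_gxDgy.
  rewrite RE !coef_d /power_profile /= mulr0 addr0 mulrDr mulr1 mulN1r mulrN.
  by rewrite opprB addrAC [_ * _%:R]mulrC -!addrA; congr (_ + _); rewrite addrCA addrA.
split=> [eq2|sumE]; last first.
  by apply: Defs.coefP => t; rewrite coef_eq sumE // subrr linear0.
have sum_y t : dup_sum (true :: t) (swap_omega phi) =
    coef (rcons (nseq (size t) false) true) phi * power_profile 1 (-1) (-1) (true :: t).
  by apply/eqP; rewrite -subr_eq0 -coef_eq eq2 linear0.
case=> [//|[] t _]; first exact: sum_y.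
rewrite -dup_sum_swap /= sum_y size_map; congr (_ * _).
rewrite /power_profile /= !all_map !mulr0 !addr0; congr (_ + _ * _).
by congr (nat_of_bool _)%:R; apply: eq_all => -[].
Qed.

Lemma grt1emP (phi : lie2) : (phi \in grt1em) <->
  [/\ coef [:: false] phi = 0, rot_inv (swap_omega phi)
    & forall s, (0 < size s)%N -> dup_sum s (swap_omega phi) =
     coef (rcons (nseq (size s).-1 false) true) phi * power_profile 1 (-1) (-1) s].
Proof.
have eq3 : (lbrk lx (lsubst ly lx phi) + lbrk ly phi == 0) <->
    rot_inv (swap_omega phi).
  rewrite -rot_inv_omega; split=> [/eqP/(congr1 lie2_val)|eq3].
    by rewrite linearD linear0.
  by apply/eqP/val_inj; rewrite linearD linear0.
rewrite inE; split.
  case/and3P=> /eqP/grt1em_no_xP phi_x /eqP eq2 /eq3 inv.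
  by split=> //; apply/grt1em_dyP.
case=> phi_x inv sumE; apply/and3P; split; last exact/eq3.
  exact/eqP/grt1em_no_xP.
exact/eqP/grt1em_dyP.
Qed.

(** * The graded isomorphism *)

Lemma grt1em_submod_closed : submod_closed grt1em.
Proof.
split=> [|c a b /grt1emP [ax inva suma] /grt1emP [bx invb sumb]].
  apply/grt1emP; rewrite (linear0 lie2_val) (linear0 swap_omega).
  split=> [|s|s _]; rewrite ?linear0 // mul0r.
  by apply: big1 => j _; rewrite linear0.
apply/grt1emP; rewrite (linearP lie2_val) (linearP swap_omega) /=; split=> [|s|s s_gt0].
- by rewrite linearP /= ax bx mulr0 addr0.
- by rewrite !linearP /= inva invb.
rewrite (linearP (coef _)) /= mulrDl -mulrA -suma // -sumb //.
rewrite /dup_sum mulr_sumr -big_split; apply: eq_bigr => j _.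
exact: linearP.
Qed.

Lemma lcomp_grt1em n : {in grt1em, forall a, lcomp n a \in grt1em}.
Proof.
move=> a /grt1emP [ax inva suma]; apply/grt1emP; split=> [|s|s s_gt0] /=.
- by rewrite coef_hcomp ax if_same.
- by rewrite !coef_swap_omega_hcomp size_rot inva.
rewrite coef_hcomp size_rcons size_nseq prednK //; have [sn|sn] := eqVneq.
  rewrite -suma //; apply: eq_bigr => j _.
  by rewrite coef_swap_omega_hcomp size_dup // eqSS ifT //; apply/eqP.
rewrite mul0r; apply: big1 => j _.
by rewrite coef_swap_omega_hcomp size_dup // eqSS (negPf sn).
Qed.

Lemma lcomp_eq0 n a : (lcomp n a == 0) <-> (forall s, size s = n -> coef s a = 0).
Proof.
split=> [/eqP/(congr1 lie2_val) eq0 s sn|eq0].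
  have := congr1 (coef s) eq0; rewrite /= !linear0 coef_hcomp sn eqxx.
  by [].
apply/eqP/val_inj; apply: Defs.coefP => s; rewrite /= !linear0 coef_hcomp.
by case: eqP => // /eq0.
Qed.

(** The power series of the divergence of [nu_em phi] all come from one sequence
    [f n = alpha_n / n], where [alpha_n] is the coefficient of [x^(n-1) y]. *)
Lemma nu_em_krv2sym_ge2 phi : phi \in grt1em -> nu_em phi \in krv2sym_ge2.
Proof.
move=> /grt1emP [phi_x inv sumE].
have phi1 s : size s = 1%N -> coef s phi = 0.
  (* At the word y the right-hand side is a multiple of 1 - 0 - 1. *)
  case: s => [|[] []] // _; have := sumE [:: true] isT.
  rewrite /dup_sum big_ord1 coef_omega /dup /= /power_profile /= => ->.
  by rewrite mulr0.
apply/and3P; split.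
- apply/andP; split; last by rewrite /= lsubst_swapK.
  apply/krv2P; split=> //.
  pose f n := coef (rcons (nseq n.-1 false) true) phi / n%:R.
  exists f, (fun n => - f n), (fun n => - f n) => s s_gt0; rewrite sumE //.
  have -> : coef (rcons (nseq (size s).-1 false) true) phi = (size s)%:R * f (size s).
    by rewrite mulrC divfK // pnatr_eq0 -lt0n.
  by rewrite /power_profile -mulrA !mulrDr !mulNr !mulrN !mul1r mulr1.
- rewrite xpair_eqE; apply/andP; split; apply/lcomp_eq0 => s /size0nil ->;
  exact: coef0_lie2.
rewrite xpair_eqE; apply/andP; split; apply/lcomp_eq0 => s s1; last exact: phi1.
by rewrite /= coef_swap phi1 // size_map.
Qed.

(** Symmetry makes the pair the image of its second component [phi]; it remains to
    identify the power series, by evaluating [dup_sum] at [x^n], [y^n] and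
    [y x^(n-1)]. *)
Lemma krv2sym_ge2P p :
  (p \in krv2sym_ge2) <-> (p.2 \in grt1em /\ p = nu_em p.2).
Proof.
split=> [|[p2 ->]]; last exact: nu_em_krv2sym_ge2.
case: p => u phi /= /and3P [/andP [krv /eqP /= phiE] _].
rewrite xpair_eqE => /andP [_ /lcomp_eq0 phi1].
have defu : u = lsubst ly lx phi by rewrite phiE lsubst_swapK.
rewrite /nu_em -defu; split=> //.
have omegaE : swap_omega phi = omega u phi by rewrite defu.
move/krv2P: krv => /= [inv [f0 [f1 [f2 sumE]]]].
apply/grt1emP; rewrite omegaE; split=> //; first exact: phi1.
move=> s s_gt0; have [s1|s1] := eqVneq (size s) 1%N.
  rewrite s1 /= phi1 // mul0r.
  rewrite /dup_sum s1 big_ord1; case: s s1 {s_gt0} => [|i []] // _.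
  rewrite /dup /= coef_omega; case: i; first by rewrite phi1.
  by rewrite defu coef_swap phi1.
have {s_gt0 s1} [n sn] : exists n, size s = n.+2.
  by case: (size s) s_gt0 s1 => [|[|n]] // _ _; exists n.
have n0 : n.+2%:R != 0 :> rat by rewrite pnatr_eq0.
have sum_n w : size w = n.+2 -> dup_sum w (omega u phi) =
    n.+2%:R * power_profile (f0 n.+2) (f1 n.+2) (f2 n.+2) w.
  by move=> wn; rewrite sumE wn.
move: {f0 f1 f2 sumE} (f0 _) (f1 _) (f2 _) sum_n => f0 f1 f2 sum_n.
have profile_pow i : power_profile f0 f1 f2 (nseq n.+2 i) = 0.
  apply: (mulfI n0); rewrite mulr0 -sum_n ?size_nseq // dup_sum_nseq /= coef_omega.
  by case: i; rewrite -[_ :: _]/(nseq n.+2 _) coef_pow_lie2 // mulr0.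
have f1E : f1 = - f0.
  apply/eqP; rewrite -addr_eq0 addrC; apply/eqP.
  have := profile_pow false; rewrite /power_profile /= all_pred1_nseq.
  by rewrite mulr1 mulr0 addr0.
have f2E : f2 = - f0.
  apply/eqP; rewrite -addr_eq0 addrC; apply/eqP.
  have := profile_pow true; rewrite /power_profile /= all_pred1_nseq.
  by rewrite mulr1 mulr0 addr0.
have f0E : n.+2%:R * f0 = coef (rcons (nseq n.+1 false) true) phi.
  have := @sum_n (true :: nseq n.+1 false); rewrite [size _]/= size_nseq => /(_ erefl).
  rewrite dup_sum_omega_y // coef_d coef_Rass dup_sum_nseq coef_pow_lie2 //.
  by rewrite mulr0 oppr0 subr0 => ->; rewrite /power_profile /= !mulr0 !addr0.
rewrite sum_n // f1E f2E sn /= -f0E /power_profile -!mulrA; congr (_ * _).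
by rewrite !mulrDr !mulrA mulr1 !mulrN1.
Qed.

Fact nu_em_linear : linear nu_em.
Proof.
move=> c a b; congr pair; apply: val_inj; apply: Defs.coefP => s.
by rewrite /= linearP [RHS]linearP /= linearP.
Qed.

HB.instance Definition _ :=
  GRing.isLinear.Build rat lie2 (lie2 * lie2)%type *:%R nu_em nu_em_linear.

Lemma nu_em_lcomp n a : nu_em (lcomp n a) = pair_comp n (nu_em a).
Proof.
congr pair; apply: val_inj; apply: Defs.coefP => s.
by rewrite /= coef_swap !coef_hcomp coef_swap size_map.
Qed.

Lemma krv2sym_ge2_submod_closed : submod_closed krv2sym_ge2.
Proof.
have [grt0 grtP] := grt1em_submod_closed.
split=> [|c p q /krv2sym_ge2P [p2 ->] /krv2sym_ge2P [q2 ->]].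
  by rewrite -(linear0 nu_em) nu_em_krv2sym_ge2.
by rewrite -linearP nu_em_krv2sym_ge2 ?grtP.
Qed.

Theorem theorem1p1 :
  {in grt1em, forall phi : lie2, nu_em phi \in krv2sym} /\
  graded_linear_iso lcomp pair_comp grt1em krv2sym_ge2 nu_em.
Proof.
split=> [phi /nu_em_krv2sym_ge2 /andP []//|].
split=> [|c a b _ _|n a _||].
- split; split.
  + exact: grt1em_submod_closed.
  + exact: lcomp_grt1em.
  + exact: krv2sym_ge2_submod_closed.
  move=> n p /krv2sym_ge2P [p2 ->]; rewrite -nu_em_lcomp.
  exact/nu_em_krv2sym_ge2/lcomp_grt1em.
- exact: linearP.
- exact: nu_em_lcomp.
- exact: nu_em_krv2sym_ge2.
by split=> [a b _ _ []|p /krv2sym_ge2P []] //; exists p.2.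
Qed.
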